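(* Let $\lambda>0$, $r>0$, and suppose $\boldsymbol{\theta}\mapsto f_{\boldsymbol{\theta}}(\mathbf{X})$ is $\mathrm{Lip}(f)$-Lipschitz (w.r.t. the $\ell_2$ norm) on the closed $\ell_2$-ball of radius $r$ around $\boldsymbol{\theta}_0$. Let $(\boldsymbol{\theta}_s)_{s\ge0}$ be an absolutely continuous trajectory with $\boldsymbol{\theta}_{s}|_{s=0}=\boldsymbol{\theta}_0$ satisfying, for almost every $s$, the selectively regularized gradient flow $$\frac{d}{ds}\boldsymbol{\theta}_s=-\nabla\widetilde{\mathcal{R}}(\boldsymbol{\theta}_s)^{\top}-\lambda_s(\boldsymbol{\theta}_s-\boldsymbol{\theta}_0),\qquad \lambda_s=\begin{cases}\lambda &\text{if } \nabla\widetilde{\mathcal{R}}(\boldsymbol{\theta}_s)(\boldsymbol{\theta}_s-\boldsymbol{\theta}_0)\ge 0,\\ 0&\text{otherwise,}\end{cases}$$ and put $\Lambda_t=\int_0^t\lambda_s\,ds$. Then for every $t\ge0$ such that $\boldsymbol{\theta}_s$ lies in that ball for all $s\in[0,t]$, $$\|\boldsymbol{\theta}_t-\boldsymbol{\theta}_0\|\le 2\,\mathrm{Lip}(f)\,\|f_{\boldsymbol{\theta}_0}(\mathbf{X})-\mathbf{Y}\|\int_0^t e^{-(\Lambda_t-\Lambda_s)}\,ds .$$ In the special case where $\lambda_s=\lambda$ for all $s\in[0,t]$, this gives $$\|\boldsymbol{\theta}_t-\boldsymbol{\theta}_0\|\le 2\,\mathrm{Lip}(f)\,\|f_{\boldsymbol{\theta}_0}(\mathbf{X})-\mathbf{Y}\|\,\frac{1-e^{-\lambda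 t}}{\lambda}.$$
   Context: A model $f_{\boldsymbol{\theta}}:\mathbb{R}^d\to\mathbb{R}$ has parameters $\boldsymbol{\theta}\in\mathbb{R}^p$, continuously differentiable in $\boldsymbol{\theta}$; $\boldsymbol{\theta}_0$ are the pretrained parameters. Data $\mathbf{x}_1,\dots,\mathbf{x}_n\in\mathbb{R}^d$, targets $\mathbf{Y}\in\mathbb{R}^n$, $f_{\boldsymbol{\theta}}(\mathbf{X})=(f_{\boldsymbol{\theta}}(\mathbf{x}_i))_{i=1}^n\in\mathbb{R}^n$, Jacobian $\nabla f_{\boldsymbol{\theta}}(\mathbf{X})\in\mathbb{R}^{n\times p}$. Squared-loss risk $\widetilde{\mathcal{R}}(\boldsymbol{\theta})=\|f_{\boldsymbol{\theta}}(\mathbf{X})-\mathbf{Y}\|_2^2$ with row-vector gradient $\nabla\widetilde{\mathcal{R}}(\boldsymbol{\theta})=2(f_{\boldsymbol{\theta}}(\mathbf{X})-\mathbf{Y})^{\top}\nabla f_{\boldsymbol{\theta}}(\mathbf{X})$. All vector norms are Euclidean. *)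

(* Defs.v *)
From HB Require Import structures.
From mathcomp Require Import all_boot all_order all_algebra.
From mathcomp Require Import all_classical all_reals all_analysis.
Set Implicit Arguments. Unset Strict Implicit. Unset Printing Implicit Defensive.
Import Order.TTheory GRing.Theory Num.Theory.
Import numFieldNormedType.Exports.
Local Open Scope classical_set_scope.
Local Open Scope ring_scope.

Section Defs.
Context {R : realType}.

Definition enorm (m : nat) (v : 'rV[R]_m) : R :=
  Num.sqrt (\sum_(i < m) v ord0 i ^+ 2).

Definition edot (m : nat) (u v : 'rV[R]_m) : R := \sum_(i < m) u ord0 i * v ord0 i.

Definition ebasis (p : nat) (j : 'I_p) : 'rV[R]_p := delta_mx ord0 j.

Definition model_out (p d n : nat) (f : 'rV[R]_p -> 'rV[R]_d -> R)
  (X : 'I_n -> 'rV[R]_d) (th : 'rV[R]_p) : 'rV[R]_n :=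
  \row_(i < n) f th (X i).

Definition jacX (p d n : nat) (f : 'rV[R]_p -> 'rV[R]_d -> R)
  (X : 'I_n -> 'rV[R]_d) (th : 'rV[R]_p) : 'M[R]_(n, p) :=
  \matrix_(i < n, j < p) ('D_(ebasis j) (fun t => f t (X i)) th).

(* Row-vector gradient of the squared loss: 2 (f_theta(X) - Y)^T grad f_theta(X). *)
Definition gradRisk (p d n : nat) (f : 'rV[R]_p -> 'rV[R]_d -> R)
  (X : 'I_n -> 'rV[R]_d) (Y : 'rV[R]_n) (th : 'rV[R]_p) : 'rV[R]_p :=
  2 *: ((model_out f X th - Y) *m jacX f X th).

Definition C1_in_theta (p d : nat) (f : 'rV[R]_p -> 'rV[R]_d -> R) : Prop :=
  forall x : 'rV[R]_d,
    (forall th, differentiable (fun t => f t x) th) /\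
    (forall j : 'I_p, continuous (fun th => 'D_(ebasis j) (fun t => f t x) th)).

Definition abs_cont_on (m : nat) (g : R -> 'rV[R]_m) (a b : R) : Prop :=
  forall e : R, 0 < e -> exists2 del : R, 0 < del &
    forall (k : nat) (lo hi : 'I_k -> R),
      (forall i, a <= lo i /\ lo i <= hi i /\ hi i <= b) ->
      (forall i j, i != j -> hi i <= lo j \/ hi j <= lo i) ->
      \sum_(i < k) (hi i - lo i) < del ->
      \sum_(i < k) enorm (g (hi i) - g (lo i)) < e.

Definition lam_sel (p d n : nat) (f : 'rV[R]_p -> 'rV[R]_d -> R)
  (X : 'I_n -> 'rV[R]_d) (Y : 'rV[R]_n) (th0 : 'rV[R]_p) (lam : R)
  (th : R -> 'rV[R]_p) (s : R) : R :=
  if 0 <= edot (gradRisk f X Y (th s)) (th s - th0) then lam else 0.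

Definition Lam_sel (p d n : nat) (f : 'rV[R]_p -> 'rV[R]_d -> R)
  (X : 'I_n -> 'rV[R]_d) (Y : 'rV[R]_n) (th0 : 'rV[R]_p) (lam : R)
  (th : R -> 'rV[R]_p) (t : R) : R :=
  \int[@lebesgue_measure R]_(s in `[0, t]) lam_sel f X Y th0 lam th s.

End Defs.

(* Main.v *)
(* Along the flow the risk has derivative - |grad|^2 - lam_s <grad, theta_s - theta_0>,
   and the selection rule makes the last term nonpositive, so the residual never
   exceeds its initial norm. Since the segment from theta_s to theta_0 stays in the
   ball, the Lipschitz bound controls the derivative of the model along
   theta_s - theta_0, whence - <grad, theta_s - theta_0> is at most
   C |theta_s - theta_0| with C = 2 Lip |f_{theta_0}(X) - Y|. Hence |theta_s - theta_0|
   has derivative at most C - lam_s |theta_s - theta_0|, which integrates to the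
   bound. The norm is smoothed at 0, and "nonpositive derivative almost everywhere
   implies nonincreasing" is proved directly for absolutely continuous functions. *)
Require Import Defs.
From HB Require Import structures.
From mathcomp Require Import all_boot all_order all_algebra.
From mathcomp Require Import all_classical all_reals all_analysis.
From mathcomp Require Import measurable_realfun.
From mathcomp Require Import ring lra.
Set Implicit Arguments. Unset Strict Implicit. Unset Printing Implicit Defensive.
Import Order.TTheory GRing.Theory Num.Theory.
Import numFieldNormedType.Exports.
Local Open Scope classical_set_scope.
Local Open Scope ring_scope.

(** * Euclidean inner product and norm on row vectors *)

Section EuclideanNorm.
Context {R : realType} {m : nat}.
Implicit Types u v w : 'rV[R]_m.

Lemma enorm_ge0 v : 0 <= enorm v.
Proof. exact: sqrtr_ge0. Qed.

Lemma edotC u v : edot u v = edot v u.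
Proof. by apply: eq_bigr => i _; rewrite mulrC. Qed.

Lemma edotDr u v w : edot u (v + w) = edot u v + edot u w.
Proof. by rewrite -big_split; apply: eq_bigr => i _; rewrite mxE mulrDr. Qed.

Lemma edotZr a u v : edot u (a *: v) = a * edot u v.
Proof. by rewrite mulr_sumr; apply: eq_bigr => i _; rewrite mxE mulrCA. Qed.

Lemma edotNr u v : edot u (- v) = - edot u v.
Proof. by rewrite -scaleN1r edotZr mulN1r. Qed.

Lemma edotvv_ge0 v : 0 <= edot v v.
Proof. by apply: sumr_ge0 => i _; rewrite -expr2 sqr_ge0. Qed.

Lemma sqr_enorm v : enorm v ^+ 2 = edot v v.
Proof.
rewrite /enorm sqr_sqrtr; last by apply: sumr_ge0 => i _; exact: sqr_ge0.
by apply: eq_bigr => i _; rewrite expr2.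
Qed.

(** Cauchy-Schwarz. With [a], [b], [c] the products uu, uv, vv, the vector [c *: u - b *: v] has
    squared norm [c * (a * c - b ^+ 2)], and [c] can be divided out unless [v] vanishes. *)
Lemma edot_sqr_le u v : edot u v ^+ 2 <= edot u u * edot v v.
Proof.
have := edotvv_ge0 v; rewrite le_eqVlt => /predU1P[v0|v_gt0].
  have v_eq0 : v = 0.
    apply/rowP => i; rewrite mxE; apply/eqP; rewrite -sqrf_eq0 expr2.
    move: (esym v0) => /eqP.
    rewrite psumr_eq0; last by move=> j _; rewrite -expr2 sqr_ge0.
    by move/allP => /(_ i (mem_index_enum i)).
  by rewrite -v0 v_eq0 -(scale0r u) edotZr mul0r expr0n mulr0.
have := edotvv_ge0 (edot v v *: u - edot u v *: v).
rewrite edotDr edotNr !edotZr edotC edotDr edotNr !edotZr.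
rewrite [edot (_ - _) v]edotC edotDr edotNr !edotZr [edot v u]edotC.
set a := edot u u; set b := edot u v; set c := edot v v.
have -> : c * (c * a - b * b) - b * (c * b - b * c) = c * (a * c - b ^+ 2).
  by ring.
by rewrite pmulr_rge0// subr_ge0.
Qed.

Lemma normr_edot_le u v : `|edot u v| <= enorm u * enorm v.
Proof.
rewrite -(@ler_pXn2r _ 2)// ?nnegrE ?mulr_ge0 ?enorm_ge0//.
by rewrite real_normK ?num_real// exprMn !sqr_enorm edot_sqr_le.
Qed.

Lemma ler_enormD u v : enorm (u + v) <= enorm u + enorm v.
Proof.
rewrite -(@ler_pXn2r _ 2)// ?nnegrE ?addr_ge0 ?enorm_ge0//.
rewrite sqr_enorm edotDr edotC edotDr [edot (u + v) v]edotC edotDr.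
rewrite -!sqr_enorm [edot v u]edotC.
have := le_trans (ler_norm _) (normr_edot_le u v).
by set a := enorm u; set b := enorm v; set c := edot u v; nra.
Qed.

Lemma enormZ a v : enorm (a *: v) = `|a| * enorm v.
Proof.
apply/eqP; rewrite -(@eqrXn2 _ 2)// ?mulr_ge0 ?enorm_ge0//.
by rewrite exprMn !sqr_enorm edotZr edotC edotZr mulrA real_normK ?num_real.
Qed.

Lemma enormN v : enorm (- v) = enorm v.
Proof. by rewrite -scaleN1r enormZ normrN1 mul1r. Qed.

Lemma ler_dist_enorm u v : `|enorm u - enorm v| <= enorm (u - v).
Proof.
rewrite ler_norml; apply/andP; split.
  rewrite lerBrDr addrC lerBlDr -(enormN (u - v)) opprB.
  by apply: le_trans (ler_enormD _ _); rewrite addrC subrK.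
rewrite lerBlDr.
by apply: le_trans (ler_enormD _ _); rewrite subrK.
Qed.

Lemma ler_coord_enorm v i : `|v ord0 i| <= enorm v.
Proof.
rewrite -(@ler_pXn2r _ 2)// ?nnegrE ?enorm_ge0// real_normK ?num_real//.
rewrite sqr_enorm /edot (bigD1 i)//= -expr2 lerDl.
by apply: sumr_ge0 => j _; rewrite -expr2 sqr_ge0.
Qed.

(** The topology on row vectors comes from the maximum norm; this bound turns Euclidean estimates
    into continuity. *)
Lemma mx_norm_le_enorm v : `|v| <= enorm v.
Proof.
rewrite /Num.Def.normr/= mx_normrE bigmax_le ?enorm_ge0// => -[i j] _ /=.
by rewrite (ord1 i) ler_coord_enorm.
Qed.

End EuclideanNorm.

(** * Monotonicity from an almost everywhere nonpositive derivative *)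

Section AbsoluteContinuity.
Context {R : realType}.
Notation mu := (@lebesgue_measure R).

(** Splitting the increment at [c] leaves only difference quotients based at [c], so
    differentiability at that single point suffices. *)
Lemma is_derive1_le0_straddle (h : R -> R) (c D e : R) :
  is_derive c 1 h D -> D <= 0 -> 0 < e ->
  exists2 del, 0 < del &
    forall u v, c - del < u -> u <= c -> c <= v -> v < c + del ->
      h v - h u <= e * (v - u).
Proof.
move=> [dh hD] D0 e0.
have /cvgrPdist_lt /(_ _ e0) : x^-1 *: ((h \o shift c) (x *: 1) - h c)
    @[x --> 0^'] --> D by rewrite -hD.
case=> del /= del0 hdel; exists del => // u v cu uc cv vc.
have near_c x : `|x - c| < del -> x != c ->
    `|D - (x - c)^-1 * (h x - h c)| < e.
  move=> xc xNc; have := hdel (x - c).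
  rewrite /ball_/= sub0r normrN subr_eq0 => /(_ xc xNc).
  by rewrite /= /GRing.scale/= mulr1 subrK.
have hv : h v - h c <= e * (v - c).
  have [->|vNc] := eqVneq v c; first by rewrite !subrr mulr0.
  have vc0 : 0 < v - c by rewrite subr_gt0 lt_neqAle eq_sym vNc.
  have := near_c v; rewrite gtr0_norm// ltrBlDl => /(_ vc vNc).
  rewrite ltr_norml => /andP[+ _].
  rewrite ltrBrDr -ltrBrDl opprK => H.
  have : (v - c)^-1 * (h v - h c) <= e by apply: ltW; lra.
  by rewrite mulrC ler_pdivrMr.
have hu : h c - h u <= e * (c - u).
  have [->|uNc] := eqVneq u c; first by rewrite !subrr mulr0.
  have uc0 : 0 < c - u by rewrite subr_gt0 lt_neqAle uNc.
  have := near_c u; rewrite distrC gtr0_norm// ltrBlDr -ltrBlDl => /(_ cu uNc).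
  rewrite ltr_norml => /andP[+ _].
  rewrite -(opprB c u) invrN mulNr -mulrN opprB => H.
  have : (c - u)^-1 * (h c - h u) <= e by apply: ltW; lra.
  by rewrite mulrC ler_pdivrMr.
by rewrite -(subrKA (h c)) -(subrKA c v) mulrDr lerD.
Qed.

Lemma negligible_open_cover (E : set R) (e : R) : 0 < e -> mu.-negligible E ->
  exists U : set R, [/\ open U, E `<=` U & (mu U <= e%:E)%E].
Proof.
move=> e0 /negligible_outer_measure E0.
by have [U [oU EU]] := outer_measure_open_le E e0; rewrite E0 add0e; exists U.
Qed.

(* A gauge argument: off a null set the increments of [h] over short intervals
   around a point are at most [e] times their length; the null set is covered
   by an open set of small measure, on which absolute continuity bounds the sum
   of the increments. Both kinds of intervals are chained from [a] to [b] by
   taking a supremum. *)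
Lemma ae_derive_le0_le (m : nat) (g : R -> 'rV[R]_m) (h : R -> R) (a b K : R) :
  a <= b -> 0 <= K -> abs_cont_on g a b ->
  (forall u v, a <= u -> u <= v -> v <= b ->
     `|h v - h u| <= K * (enorm (g v - g u) + (v - u))) ->
  {ae mu, forall s, a < s < b -> exists2 D, D <= 0 & is_derive s 1 h D} ->
  h b <= h a.
Proof.
move=> ab K0 acg hg dh.
(* The term [e * (b - a)] is paid by the points of differentiability. On the cover of the null set,
   one [e] bounds the variation of [g] and the other the total length. *)
suff H e : 0 < e -> h b - h a <= e * (b - a) + K * (e + e).
  rewrite -subr_le0; apply/ler_addgt0Pr => e e0; rewrite add0r.
  have c0 : 0 < b - a + 2 * K + 1.
    by rewrite ltr_wpDl// addr_ge0 ?subr_ge0// mulr_ge0.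
  have := H (e / (b - a + 2 * K + 1)); rewrite divr_gt0// => /(_ isT).
  move=> /le_trans; apply.
  rewrite [leLHS](_ : _ = e / (b - a + 2 * K + 1) * (b - a + 2 * K)); last by ring.
  by rewrite -mulrA ler_piMr ?(ltW e0)// mulrC ler_pdivrMr// mul1r lerDl.
move=> e0.
have [del del0 acdel] := acg e e0.
(* Below [del] strictly, for absolute continuity, and at most [e], for the length term. *)
have d2 : 0 < Num.min (del / 2) e by rewrite lt_min divr_gt0//.
(* The endpoints join the exceptional set because the derivative is only controlled inside the
   interval. *)
pose E := ~` [set s | a < s < b -> exists2 D, D <= 0 & is_derive s 1 h D]
  `|` ([set a] `|` [set b]).
have nE : mu.-negligible E.
  apply: negligibleU; first exact: dh.
  apply: negligibleU; apply/negligibleP => //; exact: lebesgue_measure_set1.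
have [U [oU EU muU]] := negligible_open_cover d2 nE.
(* The total length is compared with the measure of [U] up to [x], not with a fixed constant, so
   that the bound survives when an interval contained in [U] is appended. *)
pose good x := exists k (lo hi : 'I_k -> R), [/\
  forall i, a <= lo i /\ lo i <= hi i /\ hi i <= x,
  forall i j, i != j -> hi i <= lo j \/ hi j <= lo i,
  ((\sum_(i < k) (hi i - lo i))%:E <= mu (U `&` `[a, x]%classic))%E &
  h x - h a <= e * (x - a) + \sum_(i < k) `|h (hi i) - h (lo i)|].
suff [k [lo [hi [lohi disj len hbd]]]] : good b.
  have muUb : (mu (U `&` `[a, b]%classic) <= (Num.min (del / 2) e)%:E)%E.
    by apply: le_trans muU; apply: le_measure; rewrite ?inE//;
      [apply: measurableI => //|]; exact: open_measurable.
  have := le_trans len muUb; rewrite lee_fin le_min => /andP[len_del len_e].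
  rewrite (le_trans hbd)// lerD2l.
  apply: (@le_trans _ _
      (\sum_(i < k) K * (enorm (g (hi i) - g (lo i)) + (hi i - lo i)))).
    by apply: ler_sum => i _; have [? []] := lohi i; exact: hg.
  rewrite -mulr_sumr ler_wpM2l// big_split/= lerD//.
  by apply/ltW/acdel => //; rewrite (le_lt_trans len_del)// gtr_pMr// invf_lt1// ltr1n.
have good_a : good a.
  exists 0%N, (fun=> a), (fun=> a); split => [[]//|[]//||].
    by rewrite big_ord0 measure_ge0.
  by rewrite big_ord0 !subrr mulr0 addr0.
have good_step c : a <= c <= b -> exists2 eta, 0 < eta &
    forall u v, good u -> a <= u -> c - eta < u -> u <= c -> c <= v -> v <= b ->
      v < c + eta -> good v.
  move=> /andP[ac cb]; have [Ec|nEc] := pselect (E c).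
    have /nbhs_ballP[eta /= eta0 cU] : nbhs c U by exact: oU (EU _ Ec).
    exists eta => // u v [k [lo [hi [lohi disj len hbd]]]] au cu uc cv vb vc.
    have uv : u <= v by exact: le_trans uc cv.
    (* The new interval from [u] to [v] takes index 0 and the old ones are shifted by one. *)
    exists k.+1, (fun i => oapp lo u (unlift ord0 i)),
      (fun i => oapp hi v (unlift ord0 i)); split.
    - move=> i; case: unliftP => [j _|_] /=; last by [].
      by have [? [? ?]] := lohi j; do 2 split => //; exact: le_trans uv.
    - move=> i j; case: unliftP => [i' ->|->]; case: unliftP => [j' ->|->] //=.
      + by rewrite (inj_eq lift_inj) => /disj.
      + by move=> _; left; have [_ []] := lohi i'.
      + by move=> _; right; have [_ []] := lohi j'.
    - rewrite big_ord_recl unlift_none/=.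
      under eq_bigr do rewrite liftK/=.
      rewrite EFinD addeC.
      have mU : measurable U by exact: open_measurable.
      have uvU : `]u, v]%classic `<=` U.
        move=> x /=; rewrite in_itv/= => /andP[ux xv]; apply: cU.
        by rewrite /ball/= distrC ltr_norml; apply/andP; split; lra.
      (* Taking the new interval half-open makes it disjoint from the old part, so the measures
         add. *)
      apply: (@le_trans _ _ (mu (U `&` `[a, u]%classic) + mu `]u, v]%classic)%E).
        apply: leeD => //; rewrite lebesgue_measure_itv/= lte_fin.
        by case: ltP => // vu; rewrite lee_fin subr_le0.
      rewrite -measureU//; last 2 first.
      + exact: measurableI.
      + rewrite -subset0 => x [[_ /=]]; rewrite !in_itv/= => /andP[_ xu].
        by rewrite ltNge xu.
      apply: le_measure; rewrite ?inE//.
      + by apply: measurableU => //; exact: measurableI.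
      + exact: measurableI.
      + move=> x [[Ux]|uvx]/=; first rewrite !in_itv/= => /andP[ax xu].
          by split => //; rewrite ax (le_trans xu uv).
        split; first exact: uvU.
        by move: uvx; rewrite /= !in_itv/= => /andP[ux ->]; rewrite (le_trans au (ltW ux)).
    - rewrite big_ord_recl unlift_none/=.
      under eq_bigr do rewrite liftK/=.
      have := ler_norm (h v - h u); have : e * (u - a) <= e * (v - a).
        by rewrite ler_pM2l// lerD2r.
      by move: hbd; set s1 := \sum_(i < k) _; lra.
  have [aNc cNb dc] : [/\ c != a, c != b &
      a < c < b -> exists2 D, D <= 0 & is_derive c 1 h D].
    split; [| |exact: contrapT (fun n => nEc (or_introl n))].
    - by apply/eqP => ca; apply: nEc; right; left.
    - by apply/eqP => ca; apply: nEc; right; right.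
  have [|D D0 hD] := dc; first by rewrite !lt_neqAle eq_sym aNc ac cNb cb.
  have [eta eta0 straddle] := is_derive1_le0_straddle hD D0 e0.
  exists eta => // u v [k [lo [hi [lohi disj len hbd]]]] au cu uc cv vb vc.
  have uv : u <= v by exact: le_trans uc cv.
  exists k, lo, hi; split => //.
  - by move=> i; have [? [? ?]] := lohi i; do 2 split => //; exact: le_trans uv.
  - apply: (le_trans len); apply: le_measure; rewrite ?inE//.
    + by apply: measurableI => //; exact: open_measurable.
    + by apply: measurableI => //; exact: open_measurable.
    + move=> x [Ux] /=; rewrite !in_itv/= => /andP[ax xu].
      by split => //; rewrite ax (le_trans xu uv).
  - by have := straddle u v cu uc cv vc; move: hbd; lra.
pose S := [set x | a <= x <= b /\ good x].
have Sa : S a by rewrite /S/= lexx.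
have supS : has_sup S.
  by split; [exists a|exists b => x [/andP[]]].
have aS : a <= sup S by apply: sup_upper_bound.
have Sb : sup S <= b by apply: ge_sup; [exists a|move=> x [/andP[]]].
have [|eta eta0 step] := good_step (sup S); first by rewrite aS.
have [u [/andP[au ub] good_u] Su] := sup_adherent eta0 supS.
have uS : u <= sup S by apply: sup_upper_bound => //; rewrite /S/= au.
(* Either [b] is within one step of the supremum, or the step leads to a good point beyond it, which
   is absurd. *)
have [Seta|Seta] := ltP b (sup S + eta); first exact: (step u b).
have : S (sup S + eta / 2).
  have ? : eta / 2 < eta by rewrite gtr_pMr// invf_lt1// ltr1n.
  have ? : 0 < eta / 2 by rewrite divr_gt0.
  split; first by apply/andP; split; lra.
  by apply: (step u) => //; lra.
move=> /(sup_upper_bound supS); by rewrite gerDl leNgt divr_gt0.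
Qed.

End AbsoluteContinuity.

(** * Primitives of bounded nonnegative measurable functions *)

Section BoundedPrimitive.
Context {R : realType}.
Notation mu := (@lebesgue_measure R).
Variables (l : R -> R) (M : R).
Hypotheses (ml : measurable_fun [set: R] l) (l0 : forall s, 0 <= l s)
  (lM : forall s, l s <= M).

Let L x := \int[mu]_(s in `[0, x]) l s.

Let cc_integrable (x y : R) : mu.-integrable `[x, y] (EFin \o l).
Proof.
apply: measurable_bounded_integrable => //.
- by rewrite /= lebesgue_measure_itv/=; case: ifP; rewrite ?ltry// -EFinB ltry.
- exact: measurable_funS ml.
exists M; split; first exact: num_real.
move=> N MN s _ /=; rewrite ger0_norm//; exact: le_trans (lM s) (ltW MN).
Qed.

Let oc_integrable (x y : R) : mu.-integrable `]x, y] (EFin \o l).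
Proof. by apply: integrableS (cc_integrable x y) => //; exact: subset_itv_oc_cc. Qed.

(** Lebesgue differentiation; positivity of [x] keeps it inside the range where [L] really
    integrates [l]. *)
Lemma ae_derive_primitive : {ae mu, forall x : R, 0 < x -> is_derive x 1 L (l x)}.
Proof.
have locl : locally_integrable [set: R] l.
  split => //; first exact: openT.
  move=> K _ cK; have /integrableP[_ //] : mu.-integrable K (EFin \o l).
  apply: measurable_bounded_integrable => //.
  - exact: compact_measurable.
  - exact: compact_finite_measure.
  - exact: measurable_funS ml.
  - exists M; split; first exact: num_real.
    by move=> N MN s _ /=; rewrite ger0_norm//; exact: le_trans (lM s) (ltW MN).
have := FTC1 (cc_integrable 0) locl.
apply: filterS; first exact: (ae_filter_ringOfSetsType mu).
move=> x H x0; have [|dL L'] := H; first by rewrite lte_fin.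
by split => //; rewrite -derive1E.
Qed.

(** The domain is empty or a single point. This default value extends the increment bounds to the
    whole line. *)
Lemma primitive_neg x : x <= 0 -> L x = 0.
Proof.
rewrite le_eqVlt => /predU1P[->|x0]; rewrite /L.
  by rewrite set_itv1 Rintegral_set1.
by rewrite set_itv_ge ?Rintegral_set0// bnd_simp -ltNge.
Qed.

Lemma primitive_increment u v : u <= v -> 0 <= L v - L u <= M * (v - u).
Proof.
have M0 : 0 <= M := le_trans (l0 0) (lM 0).
have pos x y : 0 <= x -> x <= y -> 0 <= L y - L x <= M * (y - x).
  move=> x0 xy; rewrite /L Rintegral_itvB ?bnd_simp//.
  rewrite Rintegral_ge0//=.
  apply: (@le_trans _ _ (\int[mu]_(s in `]x, y]) M)).
    apply: le_Rintegral => //.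
    apply: measurable_bounded_integrable => //=; last exact: bounded_cst.
    by rewrite lebesgue_measure_itv/=; case: ifP; rewrite ?ltry// -EFinB ltry.
  rewrite Rintegral_cst//= lebesgue_measure_itv/= lte_fin.
  by case: ltgtP xy => //= -> _; rewrite subrr.
(* A negative left endpoint can be moved to 0, where [L] also vanishes; this only shortens the
   interval. *)
move=> uv; have [u0|u0] := leP 0 u; first exact: pos.
rewrite (primitive_neg (ltW u0)) subr0.
have [v0|v0] := leP 0 v; last first.
  by rewrite (primitive_neg (ltW v0)) lexx/= mulr_ge0// subr_ge0.
have := pos 0 v (lexx _) v0; rewrite (primitive_neg (lexx _)) !subr0.
move=> /andP[-> /= /le_trans]; apply; rewrite ler_wpM2l// lerDl.
by rewrite oppr_ge0 ltW.
Qed.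

Lemma continuous_primitive : continuous L.
Proof.
have M0 : 0 <= M := le_trans (l0 0) (lM 0).
move=> x; apply/cvgrPdist_lt => e e0.
(* The added 1 avoids a zero denominator when [M] is 0. *)
exists (e / (M + 1)) => /=; first by rewrite divr_gt0// ltr_wpDl.
move=> y; rewrite /ball_/= ltr_pdivlMr ?ltr_wpDl// => xy.
apply: le_lt_trans xy.
apply: (@le_trans _ _ (M * `|x - y|)); last first.
  by rewrite mulrC ler_wpM2l// lerDl.
have [yx|/ltW xy] := leP y x.
  have /andP[? ?] := primitive_increment yx.
  by rewrite !ger0_norm// subr_ge0.
have /andP[? ?] := primitive_increment xy.
by rewrite distrC [X in M * X]distrC !ger0_norm// subr_ge0.
Qed.

End BoundedPrimitive.

(** * The gradient of the squared loss, its Lipschitz bound and chain rules along a path *)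

Section LeastSquares.
Context {R : realType} {p d n : nat}.
Variables (f : 'rV[R]_p -> 'rV[R]_d -> R) (X : 'I_n -> 'rV[R]_d)
  (Y : 'rV[R]_n).
Hypothesis C1f : C1_in_theta f.
Implicit Types a w : 'rV[R]_p.

Lemma derive_ebasis (g : 'rV[R]_p -> R) a w : differentiable g a ->
  'D_w g a = \sum_(j < p) w ord0 j * 'D_(ebasis j) g a.
Proof.
move=> dg; rewrite deriveE// {1}[w]row_sum_delta linear_sum/=.
by apply: eq_bigr => j _; rewrite linearZ/= deriveE.
Qed.

(** Exchanging the sums over samples and parameters turns the Jacobian into derivatives along [w],
    the form that meets both the Lipschitz bound and the chain rule. *)
Lemma edot_gradRisk a w : edot (gradRisk f X Y a) w =
  2 * \sum_(i < n) (model_out f X a - Y) ord0 i * 'D_w (fun t => f t (X i)) a.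
Proof.
rewrite /edot /gradRisk mulr_sumr.
under eq_bigr do rewrite !mxE -mulrA mulr_suml mulr_sumr.
rewrite exchange_big/=; apply: eq_bigr => i _.
rewrite derive_ebasis; last by have [] := C1f (X i).
rewrite !mulr_sumr; apply: eq_bigr => j _; rewrite !mxE.
by congr (_ * _); rewrite -mulrA; congr (_ * _); rewrite mulrC.
Qed.

(** Since the derivative exists, one quotient with small negative [h] already approximates it within
    [e]. *)
Lemma normr_derive_le (g : 'rV[R]_p -> R) a w (K : R) : derivable g a w ->
  (forall h, -1 <= h -> h < 0 -> `|g (h *: w + a) - g a| <= K * `|h|) ->
  `|'D_w g a| <= K.
Proof.
move=> /cvgrPdist_lt dg gK; apply/ler_addgt0Pr => e e0.
have [del /= del0 hdel] := dg e e0.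
pose h := - Num.min 1 (del / 2).
have m0 : 0 < Num.min 1 (del / 2) by rewrite lt_min ltr01 divr_gt0.
have h0 : h < 0 by rewrite oppr_lt0.
have := hdel h; rewrite /ball_/= sub0r opprK ltr0_neq0// gtr0_norm//.
rewrite gt_min [del / 2 < del]gtr_pMr// invf_lt1// ltr1n orbT.
move=> /(_ isT isT)/ltW de.
rewrite -(subrK (h^-1 *: (g (h *: w + a) - g a)) ('D_w g a)).
rewrite addrC (le_trans (ler_normD _ _))// lerD//.
rewrite normrZ normfV mulrC ler_pdivrMr ?normr_gt0 ?ltr0_neq0//.
by apply: gK => //; rewrite lerN2 ge_min lexx.
Qed.

(* The segment from [a] towards the centre stays in the ball even when [a] is on
   its boundary, so the one-sided difference quotients suffice. *)
Lemma normr_edot_gradRisk_le (th0 a : 'rV[R]_p) (r Lip : R) : 0 <= Lip ->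
  (forall a b : 'rV[R]_p, enorm (a - th0) <= r -> enorm (b - th0) <= r ->
     enorm (model_out f X a - model_out f X b) <= Lip * enorm (a - b)) ->
  enorm (a - th0) <= r ->
  `|edot (gradRisk f X Y a) (a - th0)| <=
    2 * Lip * enorm (model_out f X a - Y) * enorm (a - th0).
Proof.
move=> Lip0 lipf ar; rewrite edot_gradRisk normrM normr_nat -!mulrA ler_pM2l//.
set F := model_out f X a - Y; set w := a - th0.
(* The residual [F] is frozen at [a]: [g] is the pairing of the model output with a constant vector,
   so Cauchy-Schwarz bounds its increments by those of the model. *)
pose g := \sum_(i < n) F ord0 i *: (fun t => f t (X i)).
have dg : is_derive a w g
    (\sum_(i < n) F ord0 i *: 'D_w (fun t => f t (X i)) a).
  apply: is_derive_sum => i; apply: is_deriveZ.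
  by apply/derivableP/diff_derivable; have [] := C1f (X i).
have -> : \sum_(i < n) F ord0 i * 'D_w (fun t => f t (X i)) a = 'D_w g a.
  by rewrite (@derive_val _ _ _ _ _ _ _ dg).
apply: normr_derive_le => // h h1 h0.
have gE b : g b = edot F (model_out f X b).
  rewrite /g fct_sumE; apply: eq_bigr => i _.
  by rewrite /model_out !mxE.
rewrite !gE -edotNr -edotDr (le_trans (normr_edot_le _ _))//.
rewrite [leRHS](_ : _ = enorm F * (Lip * (`|h| * enorm w))); last by ring.
rewrite ler_wpM2l ?enorm_ge0// -enormZ.
rewrite (le_trans (lipf _ _ _ _))//; last by rewrite addrK.
have -> : h *: w + a - th0 = (h + 1) *: w by rewrite scalerDl scale1r addrA.
rewrite enormZ.
rewrite (le_trans _ ar)// ler_piMl ?enorm_ge0// ler_norml; lra.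
Qed.

Lemma is_derive_comp_path (g : 'rV[R]_p -> R) (th : R -> 'rV[R]_p) v (s : R) :
  differentiable g (th s) -> is_derive s 1 th v ->
  is_derive s 1 (g \o th) ('D_v g (th s)).
Proof.
move=> dg [/derivable1_diffP dth <-]; split.
  exact/derivable1_diffP/differentiable_comp.
by rewrite !deriveE//; [rewrite diff_comp|exact: differentiable_comp].
Qed.

Lemma is_derive_sum_sqr m (q : 'I_m -> R -> R) (dq : 'I_m -> R) (s : R) :
  (forall i, is_derive s 1 (q i) (dq i)) ->
  is_derive s 1 (fun x => \sum_(i < m) q i x ^+ 2)
    (2 * \sum_(i < m) q i s * dq i).
Proof.
move=> dqi.
have -> : (fun x => \sum_(i < m) q i x ^+ 2) = \sum_(i < m) (q i) ^+ 2.
  by apply/funext => x; rewrite fct_sumE.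
rewrite mulr_sumr; apply: is_derive_sum => i.
apply: is_derive_eq; rewrite expr1 mulrA.
by rewrite /GRing.scale/=.
Qed.

Lemma is_derive_sqr_residual (th : R -> 'rV[R]_p) v (s : R) :
  is_derive s 1 th v ->
  is_derive s 1 (fun x => enorm (model_out f X (th x) - Y) ^+ 2)
    (edot (gradRisk f X Y (th s)) v).
Proof.
move=> dth; rewrite edot_gradRisk.
pose q i x := f (th x) (X i) - Y ord0 i.
have -> : (fun x => enorm (model_out f X (th x) - Y) ^+ 2) =
    (fun x => \sum_(i < n) q i x ^+ 2).
  apply/funext => x; rewrite sqr_enorm; apply: eq_bigr => i _.
  by rewrite !mxE expr2.
under eq_bigr do rewrite !mxE.
apply: is_derive_sum_sqr => i.
rewrite -[X in is_derive _ _ _ X]subr0; apply: is_deriveB.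
by apply: is_derive_comp_path => //; have [] := C1f (X i).
Qed.

Lemma is_derive_sqr_enorm (th : R -> 'rV[R]_p) v (s : R) a :
  is_derive s 1 th v ->
  is_derive s 1 (fun x => enorm (th x - a) ^+ 2) (2 * edot (th s - a) v).
Proof.
move=> [dth <-].
pose q j x := th x ord0 j - a ord0 j.
have -> : (fun x => enorm (th x - a) ^+ 2) =
    (fun x => \sum_(j < p) q j x ^+ 2).
  apply/funext => x; rewrite sqr_enorm; apply: eq_bigr => j _.
  by rewrite !mxE expr2.
rewrite /edot derive_mx//; under eq_bigr do rewrite !mxE.
apply: is_derive_sum_sqr => j.
rewrite -[X in is_derive _ _ _ X]subr0; apply: is_deriveB.
exact/derivableP/(derivable_mxP _ _ _).1.
Qed.

(** The sign of this function decides the selection, so its continuity gives measurability of the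
    rate. *)
Lemma continuous_edot_gradRisk (th0 : 'rV[R]_p) :
  continuous (fun a => edot (gradRisk f X Y a) (a - th0)).
Proof.
have sum_cont m (q : 'I_m -> 'rV[R]_p -> R) :
    (forall i, continuous (q i)) -> continuous (fun a => \sum_(i < m) q i a).
  by move=> cq; apply: continuous_big => [|i _]; [exact: add_continuous|exact: cq].
apply: (sum_cont) => j.
have -> : (fun a => gradRisk f X Y a ord0 j * (a - th0) ord0 j) =
    (fun a => (2 * \sum_(i < n) (f a (X i) - Y ord0 i) *
        'D_(ebasis j) (fun t => f t (X i)) a) * (a ord0 j - th0 ord0 j)).
  apply/funext => a; rewrite !mxE; congr (2 * _ * _).
  by apply: eq_bigr => i _; rewrite !mxE.
have mulC (u v : 'rV[R]_p -> R) :
    continuous u -> continuous v -> continuous (fun a => u a * v a).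
  by move=> cu cv a; exact: (continuousM (cu a) (cv a)).
have subC (u : 'rV[R]_p -> R) c : continuous u -> continuous (fun a => u a - c).
  by move=> cu a; exact: (continuousB (cu a) (@cst_continuous _ _ c a)).
apply: (mulC); last by apply: (subC); exact: coord_continuous.
apply: (mulC); first exact: cst_continuous.
apply: (sum_cont) => i; have [df cdf] := C1f (X i).
apply: (mulC); last exact: cdf.
by apply: (subC) => a; exact: differentiable_continuous.
Qed.

End LeastSquares.

(** Uniform continuity is absolute continuity tested on a single interval. *)
Lemma abs_cont_on_dist {R : realType} (m : nat) (g : R -> 'rV[R]_m) (a b e : R) :
  abs_cont_on g a b -> 0 < e ->
  exists2 del, 0 < del & forall u v, a <= u <= b -> a <= v <= b ->
    `|u - v| < del -> enorm (g u - g v) < e.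
Proof.
move=> acg e0; have [del del0 hdel] := acg e e0; exists del => // u v.
wlog uv : u v / u <= v.
  move=> H au av uv; have [?|/ltW vu] := leP u v; first exact: H.
  by rewrite -enormN opprB; apply: H => //; rewrite distrC.
move=> /andP[au ub] /andP[av vb]; rewrite distrC ger0_norm ?subr_ge0// => uv_del.
have := hdel 1%N (fun=> u) (fun=> v); rewrite !big_ord1 -(enormN (g u - g v)) opprB.
by apply => // i j; rewrite !ord1 eqxx.
Qed.

(** * The selectively regularized flow: decay of the residual and the displacement bound *)

Section SelectiveFlow.
Context {R : realType} {p d n : nat}.
Notation mu := (@lebesgue_measure R).
Variables (f : 'rV[R]_p -> 'rV[R]_d -> R) (X : 'I_n -> 'rV[R]_d)
  (Y : 'rV[R]_n) (th0 : 'rV[R]_p) (lam r Lip : R) (th : R -> 'rV[R]_p) (t : R).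
Hypotheses (C1f : C1_in_theta f) (lam_gt0 : 0 < lam) (Lip_ge0 : 0 <= Lip)
  (lipf : forall a b : 'rV[R]_p, enorm (a - th0) <= r -> enorm (b - th0) <= r ->
     enorm (model_out f X a - model_out f X b) <= Lip * enorm (a - b))
  (th_init : th 0 = th0)
  (th_ac : forall T : R, 0 <= T -> abs_cont_on th 0 T)
  (th_ode : {ae mu, forall s : R, 0 <= s ->
     is_derive s 1 th (- gradRisk f X Y (th s)
                       - lam_sel f X Y th0 lam th s *: (th s - th0))})
  (t_ge0 : 0 <= t)
  (th_ball : forall s : R, 0 <= s <= t -> enorm (th s - th0) <= r).

(** The regularizer is switched on only where its pairing with the gradient is nonnegative, so it
    never works against the descent. *)
Lemma edot_flow_le0 (s : R) : edot (gradRisk f X Y (th s))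
  (- gradRisk f X Y (th s) - lam_sel f X Y th0 lam th s *: (th s - th0)) <= 0.
Proof.
rewrite edotDr !edotNr edotZr -opprD oppr_le0 addr_ge0 ?edotvv_ge0//.
by rewrite /lam_sel; case: ifP => [?|_]; rewrite ?mul0r// mulr_ge0// ltW.
Qed.

(** Monotonicity is applied to the squared residual, which stays differentiable where the residual
    vanishes. *)
Lemma residual_le (s : R) : 0 <= s <= t ->
  enorm (model_out f X (th s) - Y) <= enorm (model_out f X th0 - Y).
Proof.
move=> /andP[s0 st].
pose F x := model_out f X (th x) - Y.
have lipF u v : 0 <= u <= t -> 0 <= v <= t ->
    `|enorm (F v) - enorm (F u)| <= Lip * enorm (th v - th u).
  move=> ut vt; rewrite (le_trans (ler_dist_enorm _ _))// /F.
  by rewrite opprB addrA subrK; apply: lipf; exact: th_ball.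
have r0 : 0 <= r by rewrite (le_trans (enorm_ge0 (th 0 - th0)))// th_ball// lexx.
(* A bound for the residual along the path; it makes the squared residual Lipschitz in [th] with
   constant [Lip * (2 * B)]. *)
pose B := enorm (F 0) + Lip * r.
have FB u : 0 <= u <= t -> enorm (F u) <= B.
  move=> ut; rewrite -lerBlDl (le_trans (ler_norm _))//.
  rewrite (le_trans (lipF _ _ _ ut)) ?lexx// th_init ler_wpM2l//.
  exact: th_ball.
have B0 : 0 <= B by rewrite addr_ge0 ?enorm_ge0// mulr_ge0.
suff : enorm (F s) ^+ 2 <= enorm (F 0) ^+ 2.
  by rewrite ler_pXn2r ?nnegrE ?enorm_ge0// /F th_init.
apply: (@ae_derive_le0_le _ _ th (fun x => enorm (F x) ^+ 2) 0 s (Lip * (2 * B))) => //.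
- by rewrite !mulr_ge0.
- exact: th_ac.
- move=> u v u0 uv vs.
  have ut : 0 <= u <= t by rewrite u0 (le_trans uv (le_trans vs st)).
  have vt : 0 <= v <= t by rewrite (le_trans u0 uv) (le_trans vs st).
  rewrite subr_sqr normrM [X in _ * X <= _]ger0_norm ?addr_ge0 ?enorm_ge0//.
  have Fvu : enorm (F v) + enorm (F u) <= 2 * B.
    by rewrite mulr_natl mulr2n lerD// FB.
  apply: (@le_trans _ _ (Lip * enorm (th v - th u) * (2 * B))).
    by apply: ler_pM => //; [rewrite addr_ge0 ?enorm_ge0|exact: lipF].
  rewrite mulrAC ler_wpM2l ?mulr_ge0//.
  by rewrite lerDl subr_ge0.
- move: th_ode; apply: filterS; first exact: (ae_filter_ringOfSetsType mu).
  move=> x dx /andP[x0 xs].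
  exists (edot (gradRisk f X Y (th x))
    (- gradRisk f X Y (th x) - lam_sel f X Y th0 lam th x *: (th x - th0))).
    exact: edot_flow_le0.
  by apply: is_derive_sqr_residual => //; exact: dx (ltW x0).
Qed.

(* Precomposing with the absolute value makes the flow continuous, hence the
   selection rate measurable, on all of [R]. *)
Let l := lam_sel f X Y th0 lam (fun s : R => th `|s|).

Let lE s : 0 <= s -> l s = lam_sel f X Y th0 lam th s.
Proof. by move=> s0; rewrite /l /lam_sel /= ger0_norm. Qed.

Lemma continuous_flow_norm : continuous (fun s : R => th `|s|).
Proof.
move=> s; apply/(@cvgrPdist_lt _ 'rV[R]_p) => e e0.
(* The interval up to [|s| + 1] contains the absolute value of every point within distance 1 of
   [s]. *)
have T0 : 0 <= `|s| + 1 by rewrite addr_ge0.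
have [del del0 hdel] := abs_cont_on_dist (th_ac T0) e0.
exists (Num.min del 1); first by rewrite /= lt_min del0/=.
move=> x; rewrite /ball_/= lt_min => /andP[sx_del sx1].
have ns : 0 <= `|s| <= `|s| + 1 by rewrite normr_ge0 lerDl ler01.
have nx : 0 <= `|x| <= `|s| + 1.
  rewrite normr_ge0/= -lerBlDl (le_trans (lerB_dist _ _))// distrC.
  exact: ltW.
apply: (le_lt_trans (mx_norm_le_enorm _)); apply: hdel => //.
by apply: le_lt_trans sx_del; exact: ler_dist_dist.
Qed.

Let l_measurable : measurable_fun [set: R] l.
Proof.
apply: measurable_fun_ifT => //; apply: measurable_fun_ler => //.
apply: continuous_measurable_fun => s.
exact: (@continuous_comp _ _ _ (fun s : R => th `|s|)
  (fun a => edot (gradRisk f X Y a) (a - th0)) s (@continuous_flow_norm s)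
  (@continuous_edot_gradRisk _ _ _ _ f X Y C1f th0 _)).
Qed.

Let l_ge0 s : 0 <= l s.
Proof. by rewrite /l /lam_sel; case: ifP => // _; exact: ltW. Qed.

Let l_le s : l s <= lam.
Proof. by rewrite /l /lam_sel; case: ifP => // _; exact: ltW. Qed.

Let L x := \int[mu]_(s in `[0, x]) l s.

Let LE s : Lam_sel f X Y th0 lam th s = L s.
Proof.
apply: eq_Rintegral => x; rewrite inE/= in_itv/= => /andP[x0 _].
by rewrite lE.
Qed.

Let L_incr u v : u <= v -> 0 <= L v - L u <= lam * (v - u).
Proof. exact: primitive_increment. Qed.

(** The integrand of the claimed bound, cut off after [t] so that it stays below 1 on the whole line
    and has a primitive of the kind above. *)
Let w s := if s <= t then expR (L s - L t) else 0.

Let w_measurable : measurable_fun [set: R] w.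
Proof.
apply: measurable_fun_ifT => //; first exact: measurable_fun_ler.
apply: measurableT_comp => //; apply: measurable_funB => //.
exact: continuous_measurable_fun (continuous_primitive l_measurable l_ge0 l_le).
Qed.

Let w_ge0 s : 0 <= w s.
Proof. by rewrite /w; case: ifP => // _; exact: expR_ge0. Qed.

Let w_le1 s : w s <= 1.
Proof.
rewrite /w; case: ifP => // /L_incr/andP[Lst _].
by rewrite -expR0 ler_expR -oppr_ge0 opprB.
Qed.

Let G x := \int[mu]_(s in `[0, x]) w s.

Let C := 2 * Lip * enorm (model_out f X th0 - Y).

Let C_ge0 : 0 <= C.
Proof. by rewrite !mulr_ge0 ?enorm_ge0. Qed.

Let gradRisk_le s : 0 <= s <= t ->
  - edot (gradRisk f X Y (th s)) (th s - th0) <= C * enorm (th s - th0).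
Proof.
move=> st; rewrite (le_trans (ler_norm _))// normrN.
apply: (le_trans (normr_edot_gradRisk_le Y C1f Lip_ge0 lipf (th_ball st))).
by rewrite ler_wpM2r ?enorm_ge0// ler_wpM2l ?mulr_ge0// residual_le.
Qed.

(* [sqrt (|v|^2 + eta^2)], a differentiable majorant of [|v|]. *)
Let N eta s := Num.sqrt (enorm (th s - th0) ^+ 2 + eta ^+ 2).

Let N_sqr eta s : N eta s ^+ 2 = enorm (th s - th0) ^+ 2 + eta ^+ 2.
Proof. by rewrite sqr_sqrtr// addr_ge0// sqr_ge0. Qed.

Let N_ge0 eta s : 0 <= N eta s. Proof. exact: sqrtr_ge0. Qed.

Let enorm_le_N eta s : enorm (th s - th0) <= N eta s.
Proof.
by rewrite -(@ler_pXn2r _ 2)// ?nnegrE ?enorm_ge0 ?N_ge0// N_sqr lerDl sqr_ge0.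
Qed.

Let eta_le_N eta s : 0 < eta -> eta <= N eta s.
Proof.
by move=> e0; rewrite -(@ler_pXn2r _ 2)// ?nnegrE ?(ltW e0) ?N_ge0// N_sqr lerDr sqr_ge0.
Qed.

Let N_le eta s : 0 < eta -> N eta s <= enorm (th s - th0) + eta.
Proof.
move=> /ltW e0.
rewrite -(@ler_pXn2r _ 2)// ?nnegrE ?addr_ge0 ?enorm_ge0 ?N_ge0// N_sqr sqrrD.
by rewrite lerD2r lerDl mulrn_wge0// mulr_ge0// enorm_ge0.
Qed.

(** After multiplication by [N], the regularizer cancels [l s] times the squared distance. What
    remains is the gradient term, at most [C * N], and [l s * eta ^+ 2], at most [lam * eta * N]
    because [eta] is below [N]. *)
Let N_derive_le eta s v : 0 < eta -> 0 <= s <= t ->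
  v = - gradRisk f X Y (th s) - lam_sel f X Y th0 lam th s *: (th s - th0) ->
  is_derive s 1 th v ->
  exists2 D, is_derive s 1 (N eta) D & D + l s * N eta s <= C + lam * eta.
Proof.
move=> eta0 st vE dth.
have N0 : 0 < N eta s by exact: lt_le_trans eta0 (eta_le_N s eta0).
exists ((2 * N eta s)^-1 * (2 * edot (th s - th0) v + 0)).
  apply: (@is_derive1_comp _ Num.sqrt
    (fun x => enorm (th x - th0) ^+ 2 + eta ^+ 2)).
    by apply: is_derive1_sqrt; rewrite -N_sqr exprn_gt0.
  apply: (@is_deriveD _ _ _ (fun x => enorm (th x - th0) ^+ 2) (cst (eta ^+ 2))).
  exact: is_derive_sqr_enorm.
rewrite addr0 invfM mulrACA mulVf// mul1r -(ler_pM2l N0) mulrDr mulrA mulfV ?gt_eqF//.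
rewrite mul1r vE edotDr !edotNr edotZr [edot _ (gradRisk _ _ _ _)]edotC.
rewrite -lE; last by case/andP: st.
have /andP[? ?] : 0 <= l s <= lam by rewrite l_ge0 l_le.
have := gradRisk_le st; have := N_sqr eta s; rewrite -sqr_enorm.
have := enorm_le_N eta s; have := eta_le_N s eta0; have := enorm_ge0 (th s - th0).
set a := N eta s; set x := enorm _; set g := edot _ _ => x0 ea xa aE gx.
have : C * x <= C * a by rewrite ler_wpM2l.
have : l s * eta ^+ 2 <= lam * (eta * a).
  by rewrite ler_pM// ?sqr_ge0// expr2 ler_pM2l.
have -> : a * (l s * a) = l s * x ^+ 2 + l s * eta ^+ 2.
  by rewrite mulrCA -expr2 aE mulrDr.
by nra.
Qed.

(** The [eta ^+ 2] cancels in the difference of squares, and dividing by the sum of the two values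
    of [N], which dominates the sum of the norms, gives constant 1. *)
Let N_lip eta u v : 0 < eta -> `|N eta v - N eta u| <= enorm (th v - th u).
Proof.
move=> eta0.
have a0 : 0 < N eta v + N eta u.
  by rewrite addr_gt0// (lt_le_trans eta0)// eta_le_N.
rewrite -(ler_pM2r a0) -[X in _ * X <= _](gtr0_norm a0) -normrM -subr_sqr.
rewrite !N_sqr opprD addrACA subrr addr0 subr_sqr normrM.
rewrite [X in _ * X <= _]ger0_norm ?addr_ge0 ?enorm_ge0//.
rewrite ler_pM ?addr_ge0 ?enorm_ge0//; last by rewrite lerD.
by rewrite (le_trans (ler_dist_enorm _ _))// opprB addrA subrK.
Qed.

(** Integrating factor: [W * N - A * G] has derivative [W * (N' + l * N - A)], nonpositive by the
    differential inequality, since [G] has derivative [W] before [t]. *)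
Let N_bound eta : 0 < eta -> N eta t <= eta + (C + lam * eta) * G t.
Proof.
move=> eta0.
pose W s := expR (L s - L t).
pose A := C + lam * eta.
have A0 : 0 <= A by rewrite addr_ge0// mulr_ge0// ltW.
have W0 s : 0 <= W s by exact: expR_ge0.
have W1 s : s <= t -> W s <= 1.
  by move=> /L_incr/andP[Lst _]; rewrite -expR0 ler_expR -oppr_ge0 opprB.
have r0 : 0 <= r by rewrite (le_trans (enorm_ge0 (th 0 - th0)))// th_ball// lexx.
(* The three terms bound the variation of [N], of [W] and of [A * G] respectively. *)
pose K := 1 + lam * (r + eta) + A.
suff : W t * N eta t - A * G t <= W 0 * N eta 0 - A * G 0.
  rewrite [G 0](primitive_neg _ (lexx 0)) mulr0 subr0 /W subrr expR0 mul1r.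
  rewrite -/(W 0) lerBlDr => /le_trans; apply; rewrite lerD2r.
  have -> : N eta 0 = eta.
    by rewrite /N th_init subrr -(scale0r th0) enormZ normr0 mul0r expr0n add0r
      sqrtr_sqr gtr0_norm.
  by rewrite ler_piMl ?W1// ltW.
apply: (@ae_derive_le0_le _ _ th (fun x => W x * N eta x - A * G x) 0 t K) => //.
- by rewrite !addr_ge0// mulr_ge0// ?addr_ge0// ltW.
- exact: th_ac.
- move=> u v u0 uv vt.
  have ut : u <= t := le_trans uv vt.
  have WN : `|(W v - W u) * N eta u| <= lam * (v - u) * (r + eta).
    have /andP[Luv Lvu] := L_incr uv.
    have WE : W u = W v * expR (L u - L v) by rewrite -expRD; congr expR; ring.
    (* This converts the increment of the exponential into that of [L], which is at most
       [lam * (v - u)]. *)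
    have e1 : 1 + (L u - L v) <= expR (L u - L v) by exact: expR_ge1Dx.
    have e2 : expR (L u - L v) <= 1 by rewrite -expR0 ler_expR; lra.
    have -> : W v - W u = W v * (1 - expR (L u - L v)) by rewrite WE; ring.
    rewrite ger0_norm ?mulr_ge0// ?subr_ge0//.
    apply: ler_pM => //; first by rewrite mulr_ge0// subr_ge0.
      rewrite (@le_trans _ _ (1 - expR (L u - L v)))//; last by lra.
      by rewrite ler_piMl ?W1// subr_ge0.
    by rewrite (le_trans (N_le _ eta0))// lerD2r th_ball// u0.
  have WL : `|W v * (N eta v - N eta u)| <= enorm (th v - th u).
    by rewrite normrM ger0_norm// (le_trans _ (N_lip u v eta0))// ler_piMl ?W1.
  have AG : `|A * (G v - G u)| <= A * (v - u).
    have /andP[G0 Gvu] := primitive_increment w_measurable w_ge0 w_le1 uv.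
    by rewrite normrM !ger0_norm// ler_wpM2l// -[leRHS]mul1r.
  rewrite [X in `|X|](_ : _ = W v * (N eta v - N eta u) +
    (W v - W u) * N eta u - A * (G v - G u)); last by ring.
  rewrite (le_trans (ler_normB _ _))//.
  apply: (le_trans (lerD (le_trans (ler_normD _ _) (lerD WL WN)) AG)).
  have le0 : 0 <= lam * (r + eta) by rewrite mulr_ge0 ?addr_ge0// ltW.
  have := enorm_ge0 (th v - th u); set D := enorm _ => D0.
  have : 0 <= (lam * (r + eta) + A) * D by rewrite mulr_ge0// addr_ge0.
  have : 0 <= v - u by rewrite subr_ge0.
  by rewrite /K; nra.
- have dL := ae_derive_primitive l_measurable l_ge0 l_le.
  have dG := ae_derive_primitive w_measurable w_ge0 w_le1.
  move: th_ode dL dG; apply: filterS3.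
    exact: (ae_filter_ringOfSetsType mu).
  move=> s dth dL dG /andP[s0 st].
  have st' : 0 <= s <= t by rewrite !ltW.
  have [D dN DA] := N_derive_le eta0 st' erefl (dth (ltW s0)).
  have dW : is_derive s 1 W (W s * (l s - 0)).
    apply: (@is_derive1_comp _ expR (fun x => L x - L t)).
    by apply: (@is_deriveB _ _ _ L (cst (L t))); exact: dL.
  exists (W s * D + N eta s * (W s * (l s - 0)) - A * w s).
    rewrite /w (ltW st) -/(W s) subr0.
    rewrite [leLHS](_ : _ = W s * (D + l s * N eta s - A)); last by ring.
    by rewrite mulr_ge0_le0// subr_le0.
  apply: (@is_deriveB _ _ _ (W * N eta) (A *: G)).
  by apply: is_deriveZ; exact: dG.
Qed.

Lemma enorm_flow_le : enorm (th t - th0) <=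
  2 * Lip * enorm (model_out f X th0 - Y) *
  (\int[mu]_(s in `[0, t]) expR (- (Lam_sel f X Y th0 lam th t -
                                    Lam_sel f X Y th0 lam th s))).
Proof.
have -> : \int[mu]_(s in `[0, t]) expR (- (Lam_sel f X Y th0 lam th t -
    Lam_sel f X Y th0 lam th s)) = G t.
  apply: eq_Rintegral => s; rewrite inE/= in_itv/= => /andP[_ st].
  by rewrite /w st !LE opprB.
have G0 : 0 <= G t by apply: Rintegral_ge0 => x _; exact: w_ge0.
have c0 : 0 < 1 + lam * G t by rewrite ltr_pwDl// mulr_ge0// ltW.
(* Smoothing costs [eta * (1 + lam * G t)] in all; with [eta] equal to [e / (1 + lam * G t)] this is
   exactly [e]. *)
apply/ler_addgt0Pr => e e0; have eta0 := divr_gt0 e0 c0.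
rewrite (le_trans (enorm_le_N (e / (1 + lam * G t)) _))//.
rewrite (le_trans (N_bound eta0))// -/C.
rewrite [leLHS](_ : _ = C * G t + e / (1 + lam * G t) * (1 + lam * G t)).
  by rewrite divfK// gt_eqF.
by ring.
Qed.

End SelectiveFlow.

(** * The closed form for a constant rate, and the conclusion *)

Lemma Rintegral_expR_decay {R : realType} (lam t : R) : 0 < lam -> 0 <= t ->
  \int[@lebesgue_measure R]_(s in `[0, t]) expR (- (lam * t - lam * s)) =
  (1 - expR (- (lam * t))) / lam.
Proof.
(* The case [t = 0] is separate because the fundamental theorem of calculus is applied on a
   nondegenerate interval. *)
move=> lam0; rewrite le_eqVlt => /predU1P[<-|t0].
  by rewrite set_itv1 Rintegral_set1 mulr0 oppr0 expR0 subrr mul0r.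
pose g s := expR (- (lam * t - lam * s)).
have dE (s : R) : is_derive s 1 (fun x : R => - (lam * t - lam * x)) lam.
  have -> : (fun x : R => - (lam * t - lam * x)) = lam *: id - cst (lam * t).
    by apply/funext => x; rewrite opprB.
  by apply: is_derive_eq; rewrite subr0 /GRing.scale/= mulr1.
have dg (s : R) : is_derive s 1 g (g s * lam).
  exact: (@is_derive1_comp _ expR (fun x : R => - (lam * t - lam * x))).
pose F := lam^-1 *: g.
have dF (s : R) : is_derive s 1 F (g s).
  apply: is_derive_eq; rewrite /GRing.scale/= mulrCA mulVf ?mulr1//.
  exact: lt0r_neq0.
have cF : continuous F.
  by move=> s; apply/differentiable_continuous/derivable1_diffP.
rewrite /Rintegral (@continuous_FTC2 _ g F)//.
- rewrite /= -[F t]/(lam^-1 * g t) -[F 0]/(lam^-1 * g 0) /g subrr mulr0 subr0.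
  by rewrite oppr0 expR0 -mulrBr mulrC.
- apply: continuous_subspaceT => s.
  by apply/differentiable_continuous/derivable1_diffP.
- split.
  + by move=> x _; exact: ex_derive.
  + exact/cvg_at_right_filter/cF.
  + exact/cvg_at_left_filter/cF.
- by move=> x _; rewrite derive1E derive_val.
Qed.

Unset Implicit Arguments.

Theorem theorem2 (R : realType) (p d n : nat)
  (f : 'rV[R]_p -> 'rV[R]_d -> R) (X : 'I_n -> 'rV[R]_d) (Y : 'rV[R]_n)
  (th0 : 'rV[R]_p) (lam r Lip : R) (th : R -> 'rV[R]_p) :
  C1_in_theta f ->
  0 < lam -> 0 < r -> 0 <= Lip ->
  (forall a b : 'rV[R]_p, enorm (a - th0) <= r -> enorm (b - th0) <= r ->
     enorm (model_out f X a - model_out f X b) <= Lip * enorm (a - b)) ->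
  th 0 = th0 ->
  (forall T : R, 0 <= T -> abs_cont_on th 0 T) ->
  {ae @lebesgue_measure R, forall s : R, 0 <= s ->
     is_derive s 1 th (- gradRisk f X Y (th s)
                       - lam_sel f X Y th0 lam th s *: (th s - th0))} ->
  forall t : R, 0 <= t ->
  (forall s : R, 0 <= s <= t -> enorm (th s - th0) <= r) ->
  enorm (th t - th0) <=
    2 * Lip * enorm (model_out f X th0 - Y) *
    (\int[@lebesgue_measure R]_(s in `[0, t])
        expR (- (Lam_sel f X Y th0 lam th t - Lam_sel f X Y th0 lam th s)))
  /\
  ((forall s : R, 0 <= s <= t -> lam_sel f X Y th0 lam th s = lam) ->
   enorm (th t - th0) <=
     2 * Lip * enorm (model_out f X th0 - Y) * ((1 - expR (- (lam * t))) / lam)).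

Proof.
move=> C1f lam0 _ Lip0 lipf th_init th_ac th_ode t t0 th_ball.
have bound := enorm_flow_le C1f lam0 Lip0 lipf th_init th_ac th_ode t0 th_ball.
split=> // lamE; rewrite (le_trans bound)//.
have Lam_const s : 0 <= s <= t -> Lam_sel f X Y th0 lam th s = lam * s.
  move=> /andP[s0 st]; rewrite /Lam_sel.
  transitivity (\int[@lebesgue_measure R]_(x in `[0, s]) lam).
    apply: eq_Rintegral => x; rewrite inE/= in_itv/= => /andP[x0 xs].
    by rewrite lamE// x0 (le_trans xs st).
  rewrite Rintegral_cst//= lebesgue_measure_itv/= lte_fin.
  by case: ltgtP s0 => //= [_|<-] _; rewrite ?subr0 ?mulr0.
rewrite -Rintegral_expR_decay// ler_wpM2l ?mulr_ge0 ?enorm_ge0//.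
rewrite le_eqVlt; apply/orP; left; apply/eqP.
apply: eq_Rintegral => s; rewrite inE/= in_itv/= => st.
by rewrite !Lam_const// t0 lexx.
Qed.
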